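(* Let $\Phi=C_1\wedge\dots\wedge C_m$ be a CNF over Boolean variables $x_1,\dots,x_n$, and let $G_\Phi$ be the graph with vertex set $\{x_i,\bar x_i,y_i: i=1,\dots,n\}\cup\{C_j: j=1,\dots,m\}\cup\{z\}$ whose edges are: for each $i$, the three edges of the triangle on $x_i,\bar x_i,y_i$; all edges among the vertices $C_1,\dots,C_m,z$ (a clique); and for each $j$, an edge between $C_j$ and each literal vertex ($x_i$ or $\bar x_i$) appearing in the clause $C_j$. Then $\Phi$ is not satisfiable if and only if $G_\Phi$ is a unique key graph.
   Context: A pure Horn clause $A\to v$ ($A\subseteq V$, $v\in V$) stands for $v\vee\bigvee_{a\in A}\bar a$; a Boolean function $h:\{0,1\}^V\to\{0,1\}$ is pure Horn if it is a conjunction of such clauses; $A\to v$ is an implicate of $h$ if every true point of $h$ satisfies it; $K\subseteq V$ is a key of $h$ if $K\to w$ is an implicate for all $w\in V\setminus K$; $\mathcal{K}(h)$ is the family of minimal keys. A Sperner hypergraph $\mathcal{B}\subseteq 2^V$ is a unique key hypergraph if there is exactly one pure Horn function $h$ on $V$ with $\mathcal{K}(h)=\mathcal{B}$. A graph $G=(V,E)$ is a unique key graph if $E$, viewed as a hypergraph of $2$-element subsets of $V$, is a unique key hypergraph.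
   Formalization: It is assumed that no clause contains both a variable and its negation; otherwise the claim fails, e.g. for Φ = x1 ∧ x̄1 ∧ (x1 ∨ x̄1), which is unsatisfiable although G_Φ is not a unique key graph. *)

(* Defs.v *)
(* Mathematical Components. *)
From HB Require Import structures.
From mathcomp Require Import all_boot.

Set Implicit Arguments.
Unset Strict Implicit.
Unset Printing Implicit Defensive.

Section PureHorn.
Variable V : finType.

Definition point := {ffun V -> bool}.
Definition boolfun := {ffun point -> bool}.

(* [(A, v)] is the clause A -> v; v \in A is allowed and A may be empty. *)
Definition horn_clause := ({set V} * V)%type.

Definition horn_eval (c : horn_clause) (x : point) : bool :=
  x c.2 || [exists a in c.1, ~~ x a].

Definition pure_horn (h : boolfun) : Prop :=
  exists F : {set horn_clause}, forall x, h x = [forall c in F, horn_eval c x].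

Definition implicate (h : boolfun) (c : horn_clause) : bool :=
  [forall x, h x ==> horn_eval c x].

Definition is_key (h : boolfun) (K : {set V}) : bool :=
  [forall w in ~: K, implicate h (K, w)].

Definition min_keys (h : boolfun) : {set {set V}} :=
  [set K | minset (is_key h) K].

Definition sperner (B : {set {set V}}) : Prop :=
  {in B &, forall S T : {set V}, S \subset T -> S = T}.

Definition unique_key_hypergraph (B : {set {set V}}) : Prop :=
  sperner B /\ exists! h : boolfun, pure_horn h /\ min_keys h = B.

End PureHorn.

Record sgraph := SGraph {
  vertex : finType;
  adj : rel vertex;
  adj_sym : symmetric adj;
  adj_irrefl : irreflexive adj }.

Definition edges (G : sgraph) : {set {set vertex G}} :=
  [set [set u; v] | u in vertex G, v in vertex G & adj u v].

Definition unique_key_graph (G : sgraph) : Prop :=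
  unique_key_hypergraph (edges G).

(* [(i, true)] is the positive literal of variable i, [(i, false)] its
   negation. *)
Definition literal (n : nat) := ('I_n * bool)%type.

Definition compl n (l : literal n) : literal n := (l.1, ~~ l.2).

Definition clause (n : nat) := {set literal n}.

(* A CNF is an indexed family of clauses, so a clause may be repeated. *)
Definition cnf (n m : nat) := 'I_m -> clause n.

(* A clause containing a complementary pair of literals is a tautology, not an
   elementary disjunction. *)
Definition non_tautological n (C : clause n) : Prop :=
  forall l, l \in C -> compl l \notin C.

Definition satisfies n m (a : {ffun 'I_n -> bool}) (Phi : cnf n m) : bool :=
  [forall j, exists l in Phi j, a l.1 == l.2].

Definition satisfiable n m (Phi : cnf n m) : Prop :=
  exists a : {ffun 'I_n -> bool}, satisfies a Phi.

Inductive gvertex (n m : nat) : Type :=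
  | Lit of literal n
  | Y of 'I_n
  | Cl of 'I_m
  | Z.
Arguments Lit {n m}.
Arguments Y {n m}.
Arguments Cl {n m}.
Arguments Z {n m}.

Section GVertexFinite.
Variables n m : nat.

Definition gvertex_code (u : gvertex n m) : (literal n + 'I_n) + option 'I_m :=
  match u with
  | Lit l => inl (inl l)
  | Y i => inl (inr i)
  | Cl j => inr (Some j)
  | Z => inr None
  end.

Definition gvertex_decode (c : (literal n + 'I_n) + option 'I_m) : gvertex n m :=
  match c with
  | inl (inl l) => Lit l
  | inl (inr i) => Y i
  | inr (Some j) => Cl j
  | inr None => Z
  end.

Lemma gvertex_codeK : cancel gvertex_code gvertex_decode.
Proof. by case. Qed.

HB.instance Definition _ := Finite.copy (gvertex n m) (can_type gvertex_codeK).

End GVertexFinite.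

Definition cnf_adj n m (Phi : cnf n m) (u v : gvertex n m) : bool :=
  match u, v with
  | Lit l, Lit k => (l.1 == k.1) && (l.2 != k.2)
  | Lit l, Y i | Y i, Lit l => l.1 == i
  | Cl j, Cl k => j != k
  | Cl _, Z | Z, Cl _ => true
  | Lit l, Cl j | Cl j, Lit l => l \in Phi j
  | _, _ => false
  end.

Lemma cnf_adj_sym n m (Phi : cnf n m) : symmetric (cnf_adj Phi).
Proof.
by case=> [l|i|j|] [k|i'|j'|] //=; rewrite eq_sym // [X in _ && ~~ X]eq_sym.
Qed.

Lemma cnf_adj_irrefl n m (Phi : cnf n m) : irreflexive (cnf_adj Phi).
Proof. by case=> [l|i|j|] //=; rewrite !eqxx. Qed.

Definition cnf_graph n m (Phi : cnf n m) : sgraph :=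
  SGraph (cnf_adj_sym Phi) (cnf_adj_irrefl Phi).

(* Main.v *)
(* A pure Horn function is determined by its closed sets (the supports of its
   true points).  If the minimal keys are the edges of G, the proper closed sets
   are stable and every stable set lies in a proper closed set.  The largest
   such family consists of all stable sets, and it is the only one exactly when
   no implication I -> v can be added to it, i.e. when there is no stable set I
   and vertex v outside I with I + v stable and N(v) contained in N(I).
   In the graph of a CNF such a pair must have v = z, and then the literals in I
   are a satisfying assignment. *)
Require Import Defs.
From mathcomp Require Import all_boot.

Set Implicit Arguments.
Unset Strict Implicit.
Unset Printing Implicit Defensive.

(** * Keys of pure Horn functions *)

Section PureHornFacts.
Variable V : finType.
Implicit Types (x : point V) (h : boolfun V) (K L : {set V}).

Lemma horn_evalP (c : horn_clause V) x :
  reflect ({in c.1, forall a, x a} -> x c.2) (horn_eval c x).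
Proof.
rewrite /horn_eval; apply: (iffP orP) => [[//|/exists_inP[a aA /negP xa]] xA|H].
  by case: xa; apply: xA.
case: (boolP [exists a in c.1, ~~ x a]) => [|/exists_inPn xA]; first by right.
by left; apply: H => a /xA /negPn.
Qed.

Lemma is_keyP h K :
  reflect (forall x, h x -> {in K, forall a, x a} -> forall w, x w)
          (is_key h K).
Proof.
apply: (iffP forall_inP) => [H x hx xK w|H w _].
  have [/xK //|wK] := boolP (w \in K).
  have /H/forallP/(_ x) : w \in ~: K by rewrite inE.
  by rewrite hx => /horn_evalP; apply.
by apply/forallP => x; apply/implyP => hx; apply/horn_evalP => /= xK; apply: H.
Qed.

Lemma is_key_subset h K L : K \subset L -> is_key h K -> is_key h L.
Proof.
move=> /subsetP KL /is_keyP H; apply/is_keyP => x hx xL.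
by apply: H => // a /KL /xL.
Qed.

Lemma is_keyPn h K :
  ~~ is_key h K ->
  exists x, [/\ h x, {in K, forall a, x a} & exists w, ~~ x w].
Proof.
move=> /forall_inPn[w _ /forallPn[x]]; rewrite negb_imply => /andP[hx].
rewrite /horn_eval negb_or => /andP[xw /exists_inPn xK].
by exists x; split=> [//|a /xK /negPn //|]; exists w.
Qed.

Definition horn_of (F : {set horn_clause V}) : boolfun V :=
  [ffun x => [forall c in F, horn_eval c x]].

Lemma horn_ofP (F : {set horn_clause V}) x :
  reflect {in F, forall c, horn_eval c x} (horn_of F x).
Proof. by rewrite ffunE; apply: forall_inP. Qed.

Lemma horn_of_pure (F : {set horn_clause V}) : pure_horn (horn_of F).
Proof. by exists F => x; rewrite ffunE. Qed.

End PureHornFacts.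

(** * Graphs whose edges are the minimal keys *)

Section UniqueKeyGraph.
Variable G : sgraph.
Implicit Types (u v w : vertex G) (S K I : {set vertex G}).
Implicit Types (h : boolfun (vertex G)) (x : point (vertex G)).

Definition stable S := [forall u in S, forall v in S, ~~ adj u v].

Lemma stableP S : reflect {in S &, forall u v, ~~ adj u v} (stable S).
Proof.
by apply: (iffP forall_inP) => H u; [move=> v /H/forall_inP | move=> uS];
  [apply | apply/forall_inP => v; apply: H].
Qed.

Lemma stablePn S :
  reflect (exists u v, [/\ u \in S, v \in S & adj u v]) (~~ stable S).
Proof.
apply: (iffP forall_inPn) => [[u uS /forall_inPn[v vS /negPn uv]]|].
  by exists u, v.
by case=> u [v [uS vS uv]]; exists u => //; apply/forall_inPn; exists v;
  rewrite ?negbK.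
Qed.

Lemma edgesP S :
  reflect (exists u v, adj u v /\ S = [set u; v]) (S \in edges G).
Proof.
apply: (iffP imset2P) => [[u v _]|[u [v [uv ->]]]].
  by rewrite !inE => /andP[_ uv] ->; exists u, v.
by exists u v => //; rewrite !inE.
Qed.

Lemma edge_unstable S : S \in edges G -> ~~ stable S.
Proof.
by case/edgesP => u [v [uv ->]]; apply/stablePn; exists u, v;
  rewrite !inE !eqxx orbT.
Qed.

Lemma unstable_edge S : ~~ stable S -> exists2 e, e \in edges G & e \subset S.
Proof.
case/stablePn => u [v [uS vS uv]]; exists [set u; v].
  by apply/edgesP; exists u, v.
by rewrite subUset !sub1set uS.
Qed.

Lemma edges_sperner : sperner (edges G).
Proof.
move=> _ _ /edgesP[u [v [uv ->]]] /edgesP[u' [v' [uv' ->]]] sub.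
have neq a b : adj a b -> a != b.
  by apply: contraTneq => ->; rewrite adj_irrefl.
by apply/eqP; rewrite eqEcard sub !cards2 !neq.
Qed.

(** Keys and unstable sets are both closed under supersets, and such a family is determined by its
    minimal members; those of the unstable sets are the edges. *)
Lemma min_keys_edgesP h :
  min_keys h = edges G <-> forall K, is_key h K = ~~ stable K.
Proof.
split=> [E K|H].
  apply/idP/idP => [/minset_exists[e mine]|/unstable_edge[e]].
    have /edge_unstable : e \in edges G by rewrite -E inE.
    move=> /stablePn[u [v [ue ve uv]]] /subsetP eK.
    by apply/stablePn; exists u, v; split; [apply: eK|apply: eK|].
  by rewrite -E inE => /minsetp ? /is_key_subset; apply.
apply/setP => S; rewrite inE; apply/minsetP/idP => [[]|SE].
  rewrite H => /unstable_edge[e eE eS] /(_ e); rewrite H edge_unstable //.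
  by move=> <-.
rewrite H edge_unstable //; split=> // T; rewrite H => /unstable_edge[e eE eT] TS.
have eS := edges_sperner eE SE (subset_trans eT TS).
by apply/eqP; rewrite eqEsubset TS -eS.
Qed.

Definition dominated I v : Prop :=
  [/\ v \notin I, stable (v |: I) &
      forall u, adj v u -> exists2 w, w \in I & adj w u].

(** The conjunction of these clauses is true exactly at the indicators of stable sets and at the
    all-true point; it is the largest candidate function. *)
Definition edge_clauses : {set horn_clause (vertex G)} :=
  [set c | c.1 \in edges G].

Lemma edge_clauses_is_key (F : {set horn_clause (vertex G)}) K :
  edge_clauses \subset F -> ~~ stable K -> is_key (horn_of F) K.
Proof.
move=> /subsetP EF /unstable_edge[e eE /subsetP eK].
apply/is_keyP => x /horn_ofP hx xK w.
have /EF/hx/horn_evalP : (e, w) \in edge_clauses by rewrite inE.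
by apply=> a /eK /xK.
Qed.

Lemma stable_horn_of S x :
  stable S -> (forall a, x a = (a \in S)) -> horn_of edge_clauses x.
Proof.
move=> /stableP stS xS; apply/horn_ofP => c; rewrite inE => /edge_unstable.
move=> /stablePn[u [v [uc vc uv]]]; apply/horn_evalP => xc.
by have := stS u v; rewrite -!xS (xc u) // (xc v) // uv => /(_ isT isT).
Qed.

(** The indicator of a stable [K] is a true point, so [K] can be a key only if it is the whole
    vertex set, which an edge rules out. *)
Lemma min_keys_edge_clauses :
  edges G != set0 -> min_keys (horn_of edge_clauses) = edges G.
Proof.
move=> /set0Pn[e /edge_unstable/stablePn[u [v [_ _ uv]]]].
apply/min_keys_edgesP => K; apply/idP/idP; last exact: edge_clauses_is_key.
apply: contraTN => stK; apply/negP => /is_keyP/(_ [ffun a => a \in K]) H.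
have KT w : w \in K.
  have := H _ _ w; rewrite ffunE; apply; last by move=> a; rewrite ffunE.
  by apply: (stable_horn_of stK) => a; rewrite ffunE.
by have /stableP/(_ u v (KT _) (KT _)) := stK; rewrite uv.
Qed.

(* A stable K containing I is contained in the set K + v, which is still stable
   and satisfies I -> v; hence adding that clause creates no new key. *)
Lemma min_keys_dominated I v :
  edges G != set0 -> dominated I v ->
  min_keys (horn_of ((I, v) |: edge_clauses)) = edges G.
Proof.
move=> /set0Pn[e /edge_unstable/stablePn[p [q [_ _ pq]]]] [vI stvI Nv].
apply/min_keys_edgesP => K; apply/idP/idP; last first.
  exact/edge_clauses_is_key/subsetUr.
apply: contraTN => stK; apply/negP => /is_keyP H.
have [L [KL stL closed]] :
  exists L : {set vertex G}, [/\ K \subset L, stable L & I \subset L -> v \in L].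
  have [IK|nIK] := boolP (I \subset K); last by exists K; split=> // /(negP nIK).
  exists (v |: K); split=> [||_]; rewrite ?subsetUr ?setU11 //.
  (* A neighbour of [v] in [K] would be adjacent to a vertex of [I], hence of [K], against
     stability. *)
  have nadj w : w \in K -> ~~ adj v w.
    move=> wK; apply/negP => /Nv[t /(subsetP IK) tK tw].
    by have /stableP/(_ t w tK wK) := stK; rewrite tw.
  apply/stableP => a b /setU1P[->|aK] /setU1P[->|bK].
  - by rewrite adj_irrefl.
  - exact: nadj.
  - by rewrite adj_sym nadj.
  - by have /stableP := stK; apply.
have LT w : w \in L.
  have := H [ffun a => a \in L] _ _ w; rewrite ffunE; apply; last first.
    by move=> a /(subsetP KL); rewrite ffunE.
  apply/horn_ofP => c /setU1P[->|].
    apply/horn_evalP => /= xI; rewrite ffunE closed //.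
    by apply/subsetP => a /xI; rewrite ffunE.
  apply/horn_ofP: c.
  by apply: (stable_horn_of stL) => a; rewrite ffunE.
by have /stableP/(_ p q (LT _) (LT _)) := stL; rewrite pq.
Qed.

(** The hard inclusion: let [x] satisfy the edge clauses but violate a clause [A -> w] of [h]. The
    support of [x] extends to a stable [K] with [w |: K] unstable. As [K] is no key, some true point
    [y] of [h] contains [K] without being all-true; but [A -> w] forces [w] in [y], and [w |: K] is
    a key. *)
Lemma unique_horn_of h :
  (forall I v, ~ dominated I v) ->
  pure_horn h -> min_keys h = edges G -> horn_of edge_clauses = h.
Proof.
move=> ndom [F hF] /min_keys_edgesP keyE.
have full y S : h y -> {in S, forall a, y a} -> ~~ stable S -> forall w, y w.
  by move=> hy yS; rewrite -keyE => /is_keyP; apply.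
apply/ffunP => x; apply/horn_ofP/idP => [hx|hx c]; last first.
  rewrite inE => /edge_unstable stc; apply/horn_evalP => xc.
  exact: full hx xc stc c.2.
rewrite hF; apply/forall_inP => -[A w] cF; apply/horn_evalP => /= xA.
pose S := [set a | x a]; apply: contraT => xw.
have stS : stable S.
  apply: contraT => /unstable_edge[e eE /subsetP eS].
  have /hx/horn_evalP/= H : (e, w) \in edge_clauses by rewrite inE.
  by rewrite H // in xw => a /eS; rewrite inE.
have [K [SK stK stwK]] :
  exists K : {set vertex G}, [/\ S \subset K, stable K & ~~ stable (w |: K)].
  have [stwS|nst] := boolP (stable (w |: S)); last by exists S.
  (* As [S] does not dominate [w], some neighbour [u] of [w] can join [S] without breaking
     stability. *)
  have [u wu uS] : exists2 u, adj w u & {in S, forall t, ~~ adj t u}.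
    have [/exists_inP[u wu /forall_inP uS]|/exists_inPn H] :=
      boolP [exists u in adj w, [forall t in S, ~~ adj t u]]; first by exists u.
    case: (ndom S w); split=> [|//|u /H]; first by rewrite inE.
    by case/forall_inPn => t tS /negPn tu; exists t.
  exists (u |: S); split; first exact: subsetUr.
    apply/stableP => a b /setU1P[->|aS] /setU1P[->|bS].
    - by rewrite adj_irrefl.
    - by rewrite adj_sym uS.
    - exact: uS.
    - by have /stableP := stS; apply.
  by apply/stablePn; exists w, u; rewrite !inE !eqxx ?orbT.
have /is_keyPn[y [hy yK [t]]] : ~~ is_key h K by rewrite keyE negbK.
rewrite (full y (w |: K)) // => a /setU1P[->|]; last exact: yK.
have /forall_inP/(_ _ cF)/horn_evalP : [forall c in F, horn_eval c y].
  by rewrite -hF.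
by apply=> b /= /xA xb; apply/yK/(subsetP SK); rewrite inE.
Qed.

Lemma unique_key_graphP :
  unique_key_graph G <->
  edges G != set0 /\ forall I v, ~ dominated I v.
Proof.
split=> [[_ [h [[hp hk] huniq]]]|[E0 ndom]]; last first.
  split; first exact: edges_sperner.
  exists (horn_of edge_clauses); split.
    by split; [apply: horn_of_pure|apply: min_keys_edge_clauses].
  by move=> h [hp hk]; apply: unique_horn_of.
(* The whole vertex set is a key of any function, so it contains a minimal key, which is an edge. *)
have E0 : edges G != set0.
  have keyT : is_key h setT.
    by apply/is_keyP => x _ xT w; apply: xT; rewrite inE.
  have [e mine _] := minset_exists keyT.
  by apply/set0Pn; exists e; rewrite -hk inE.
split=> // I v dom; have [vI stvI _] := dom.
have eq1 := huniq _ (conj (horn_of_pure _) (min_keys_edge_clauses E0)).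
have eq2 := huniq _ (conj (horn_of_pure _) (min_keys_dominated E0 dom)).
(* The indicator of [I] separates the two functions: it satisfies the edge clauses and falsifies
   [I -> v]. *)
pose x : point (vertex G) := [ffun a => a \in I].
have : horn_of edge_clauses x.
  apply: (@stable_horn_of I) => [|a]; last by rewrite ffunE.
  apply/stableP => a b aI bI.
  by have /stableP := stvI; apply; rewrite inE ?aI ?bI orbT.
rewrite -eq1 eq2 => /horn_ofP/(_ _ (setU11 _ _))/horn_evalP/=.
rewrite ffunE (negPf vI) => H.
by apply: notF; apply: H => a; rewrite ffunE.
Qed.

End UniqueKeyGraph.

(** * Domination in the graph of a CNF *)

Section CnfGraph.
Variables (n m : nat) (Phi : cnf n m).
Local Notation G := (cnf_graph Phi).
Implicit Types (I : {set vertex G}).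

(** The true literals form a stable set; the neighbours of [Z] are the clauses, and each contains a
    true literal. *)
Lemma satisfiable_dominated :
  satisfiable Phi -> exists I, @dominated G I Z.
Proof.
case=> a /forallP sat.
exists [set u | if u is Lit l then a l.1 == l.2 else false].
split; first by rewrite inE.
  apply/stableP => u v /setU1P[->|]; last rewrite inE; last first.
    case: u => // l /eqP la /setU1P[->//|]; rewrite inE.
    case: v => // k /eqP ka /=; apply/negP => /andP[/eqP lk].
    by rewrite -la -ka lk eqxx.
  by move=> /setU1P[->//|]; rewrite inE; case: v.
case=> //= j _; have /exists_inP[l lj al] := sat j.
by exists (Lit l); rewrite ?inE.
Qed.

Lemma dominated_satisfiable I (v : vertex G) :
  (forall j, non_tautological (Phi j)) -> dominated I v -> satisfiable Phi.
Proof.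
move=> hPhi [vI /stableP st Nv].
have stI u w : u \in I -> w \in I -> ~~ cnf_adj Phi u w.
  by move=> uI wI; apply: st; rewrite inE ?uI ?wI orbT.
have stv w : w \in I -> ~~ cnf_adj Phi v w.
  by move=> wI; apply: st; rewrite ?setU11 // inE wI orbT.
case: v vI stv Nv {st} => [l|i|j|] vI stv Nv.
(* Case of a literal: its [Y] neighbour forces a literal of the same variable into [I], and
   stability makes it [l] itself. *)
- have [|[k| | |] //= kI /eqP kl] := Nv (Y l.1); first exact: eqxx.
  have /= := stv _ kI; rewrite kl eqxx /= negbK => /eqP l2.
  by case/negP: vI; rewrite [l]surjective_pairing -kl l2 -surjective_pairing.
(* Case of [Y i]: both literals of [i] must be covered by clauses in [I]; these coincide, since
   clauses form a clique, giving a tautological clause. *)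
- have cover b : exists2 j, (Cl j : vertex G) \in I & (i, b) \in Phi j.
    have [|[k|i'|j|] //= uI] := Nv (Lit (i, b)); first by rewrite /= eqxx.
    + by case/andP=> /eqP ki _; have := stv _ uI; rewrite /= ki eqxx.
    + by move=> /eqP ii'; rewrite -ii' (negPf vI) in uI.
    + by exists j.
  have [[j jI ij] [k kI ik]] := (cover true, cover false).
  have /= := stI _ _ jI kI; rewrite negbK => /eqP jk.
  by have := hPhi _ _ ij; rewrite /compl /= jk ik.
(* Case of a clause: covering [Z] needs a clause in [I], which by stability is [j] itself. *)
- have [//|[| |k|] //= kI _] := Nv Z.
  have /= := stv _ kI; rewrite negbK => /eqP jk.
  by rewrite jk kI in vI.
(* Case of [Z]: every clause is covered by a literal in [I]. Variables without a literal in [I]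
   default to false; a negative literal in [I] excludes the positive one. *)
- exists [ffun i => (Lit (i, true) : vertex G) \in I]; apply/forallP => j.
  have [//|[l| |k|] //= lI] := Nv (Cl j).
  + move=> lj; apply/exists_inP; exists l => //; rewrite ffunE.
    case: l lI {lj} => i [] /= lI; first by rewrite lI.
    by apply/eqP/negP => /(stI _ _ lI); rewrite /= eqxx.
  + by have := stv _ lI.
  + by rewrite lI in vI.
Qed.

End CnfGraph.

Theorem theorem3 (n m : nat) (Phi : cnf n m)
  (hPhi : forall j : 'I_m, non_tautological (Phi j)) :
  ~ satisfiable Phi <-> unique_key_graph (cnf_graph Phi).
Proof.
split=> [unsat|/unique_key_graphP[_ ndom] /satisfiable_dominated[I]]; last first.
  exact: ndom.
have ndom I v : ~ @dominated (cnf_graph Phi) I v.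
  by move=> /(dominated_satisfiable hPhi).
apply/unique_key_graphP; split=> //.
(* Without edges the vertex z is isolated, hence dominated by the empty set. *)
apply/eqP => E0; apply: (ndom set0 Z).
have noadj u v : @adj (cnf_graph Phi) u v -> False.
  move=> uv; have : [set u; v] \in edges (cnf_graph Phi).
    by apply/edgesP; exists u, v.
  by rewrite E0 inE.
split; rewrite ?inE //; first by apply/stableP => u v _ _; apply/negP => /noadj.
by move=> u /noadj.
Qed.
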